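(* Let $(\Omega,\Sigma,\mu)$ be a measure space with $\mu$ a nonnegative, finite, complete measure not vanishing identically, and let $p>0$. Then the metrics $\rho_p$ and $d_p$ on $L^+_p$ are equivalent (induce the same topology) with the metric $\delta_p$ given on $L^+_p$ by $$\delta_p(f,g)=\inf_{t>0}\big[t+\mu(\{x\in\Omega:|f(x)-g(x)|\ge t\})\big]+\left(\int_\Omega\big|\log^+|f(x)|-\log^+|g(x)|\big|^p\,d\mu\right)^{1/\max\{p,1\}},\quad f,g\in L^+_p.$$
   Context: Let $\log^+a=\max\{\log a,0\}$ (with $\log^+0=0$). For $p>0$, $L^+_p=L^+_p(\mu)$ is the set of all (equivalence classes modulo $\mu$-a.e. equality of) $\Sigma$-measurable complex functions $f$ on $\Omega$ with $\int_\Omega(\log^+|f|)^p\,d\mu<\infty$; equivalently, with $(\|f\|_p)^p:=\int_\Omega(\log(1+|f|))^p\,d\mu<\infty$. The metric $d_p$ on $L^+_p$ is $$d_p(f,g)=\inf_{t>0}\big[t+\mu(\{x\in\Omega:|f(x)-g(x)|\ge t\})\big]+\int_\Omega\big|(\log^+|f(x)|)^p-(\log^+|g(x)|)^p\big|\,d\mu.$$ The metric $\rho_p$ on $L^+_p$ is $\rho_p(f,g)=\|f-g\|_p$ if $p>1$, and $\rho_p(f,g)=(\|f-g\|_p)^p$ if $0<p\le1$. *)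

(* Defs.v *)
From HB Require Import structures.
From mathcomp Require Import all_boot all_order all_algebra.
From mathcomp Require Import all_classical all_reals all_analysis.
From mathcomp Require Import measurable_realfun complex.

Set Implicit Arguments.
Unset Strict Implicit.
Unset Printing Implicit Defensive.

Import Order.TTheory GRing.Theory Num.Theory.

Local Open Scope classical_set_scope.
Local Open Scope ring_scope.
Local Open Scope complex_scope.

Section metric_topology.
Context {R : realType} {X : Type}.
Implicit Types D : X -> X -> R.

Definition is_metric D : Prop :=
  [/\ forall x y, 0 <= D x y,
      forall x y, D x y = 0 <-> x = y,
      forall x y, D x y = D y x
    & forall x y z, D x z <= D x y + D y z].

Definition metric_open D (U : set X) : Prop :=
  forall x, U x -> exists2 e : R, 0 < e & [set y | D x y < e] `<=` U.

Definition same_topology D1 D2 : Prop :=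
  forall U : set X, metric_open D1 U <-> metric_open D2 U.

End metric_topology.

(* [ln] vanishes on nonpositive reals, so [logp 0 = 0]. *)
Definition logp {R : realType} (a : R) : R := Num.max (ln a) 0.

(* [Normc.normc] is the R-valued modulus on R[i]. *)
Notation normc := Normc.normc.

Definition cmeasurable d (T : measurableType d) (R : realType) (f : T -> R[i]) :=
  measurable_fun setT (fun x => complex.Re (f x)) /\
  measurable_fun setT (fun x => complex.Im (f x)).

Record LplusFun d (T : measurableType d) (R : realType)
    (mu : {measure set T -> \bar R}) (p : R) := MkLplusFun {
  Lplus_fun :> T -> R[i];
  Lplus_measurable : cmeasurable Lplus_fun;
  Lplus_finite : (\int[mu]_x (logp (normc (Lplus_fun x)) `^ p)%:E < +oo)%E }.

HB.instance Definition _ d (T : measurableType d) (R : realType)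
  (mu : {measure set T -> \bar R}) (p : R) := gen_eqMixin (LplusFun mu p).
HB.instance Definition _ d (T : measurableType d) (R : realType)
  (mu : {measure set T -> \bar R}) (p : R) := gen_choiceMixin (LplusFun mu p).

Section Lplus.
Context d (T : measurableType d) (R : realType).
Variables (mu : {measure set T -> \bar R}) (p : R).
Local Notation L := (LplusFun mu p).

Definition Lplus_eq (f g : L) : bool := `[< (f : T -> R[i]) = g %[ae mu] >].

Let Lplus_eq_refl : reflexive Lplus_eq.
Proof. by move=> f; apply/asboolP/aeW. Qed.

Let Lplus_eq_sym : symmetric Lplus_eq.
Proof. by move=> f g; apply/idP/idP => /asboolP h; apply/asboolP/ae_eq_sym. Qed.

Let Lplus_eq_trans : transitive Lplus_eq.
Proof.
by move=> g f h /asboolP fg /asboolP gh; apply/asboolP/(ae_eq_trans fg gh).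
Qed.

Canonical Lplus_eq_canonical :=
  EquivRel Lplus_eq Lplus_eq_refl Lplus_eq_sym Lplus_eq_trans.

Definition Lplus : Type := {eq_quot Lplus_eq}%qT.
HB.instance Definition _ := Choice.on Lplus.
HB.instance Definition _ := EqQuotient.on Lplus.

End Lplus.

(* On [LplusFun mu p] over a finite measure all the integrals below are finite,
   so the real-valued [Rintegral] and [fine] lose no information. *)
Section distances.
Context d (T : measurableType d) (R : realType).
Variables (mu : {measure set T -> \bar R}) (p : R).
Implicit Types f g : T -> R[i].

(* The infimum of a nonempty set of nonnegative reals. *)
Definition dist_in_measure f g : R :=
  inf [set t + fine (mu [set x | t <= normc (f x - g x)])
        | t in [set t : R | 0 < t]].

Definition lognorm f : R := (\int[mu]_x (ln (1 + normc (f x)) `^ p))%R `^ p^-1.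

Definition rho_fun f g : R :=
  if 1 < p then lognorm (fun x => f x - g x)
  else lognorm (fun x => f x - g x) `^ p.

Definition d_fun f g : R :=
  dist_in_measure f g +
  (\int[mu]_x `|logp (normc (f x)) `^ p - logp (normc (g x)) `^ p|)%R.

Definition delta_fun f g : R :=
  dist_in_measure f g +
  (\int[mu]_x (`|logp (normc (f x)) - logp (normc (g x))| `^ p))%R
    `^ (Num.max p 1)^-1.

End distances.

Section ae_invariance.
Context d (T : measurableType d) (R : realType).
Variables (mu : {measure set T -> \bar R}) (p : R).
Implicit Types f g : T -> R[i].

Lemma measurable_normc f : cmeasurable f ->
  measurable_fun setT (fun x => normc (f x)).
Proof.
move=> [mRe mIm].
rewrite (_ : (fun x => _) =
    (fun x => (complex.Re (f x) ^+ 2 + complex.Im (f x) ^+ 2) `^ 2^-1)); last first.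
  apply/funext => x; rewrite powR12_sqrt ?addr_ge0 ?sqr_ge0//.
  by case: (f x).
apply: (measurableT_comp (measurable_powR _)).
by apply: measurable_funD; apply: measurable_funX.
Qed.

Lemma cmeasurableB f g : cmeasurable f -> cmeasurable g ->
  cmeasurable (fun x => f x - g x).
Proof.
move=> [f1 f2] [g1 g2]; split.
- rewrite (_ : (fun x => _) = (fun x => complex.Re (f x) - complex.Re (g x))).
    exact: measurable_funB.
  by apply/funext => x; case: (f x) => a b; case: (g x).
- rewrite (_ : (fun x => _) = (fun x => complex.Im (f x) - complex.Im (g x))).
    exact: measurable_funB.
  by apply/funext => x; case: (f x) => a b; case: (g x).
Qed.

Lemma measurable_logp_normc f : cmeasurable f ->
  measurable_fun setT (fun x => logp (normc (f x))).
Proof.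
move=> mf; apply: (measurable_maxr (f := fun x => ln (normc (f x)))) => //.
by apply: (measurableT_comp (@measurable_ln R)); exact: measurable_normc.
Qed.

Lemma ae_eq_Rintegral (h k : T -> R) :
  measurable_fun setT h -> measurable_fun setT k ->
  h = k %[ae mu] -> (\int[mu]_x h x)%R = (\int[mu]_x k x)%R.
Proof.
move=> mh mk hk; rewrite /Rintegral; congr fine.
apply: ae_eq_integral => //; [exact/measurable_EFinP|exact/measurable_EFinP|].
by apply: filterS hk => x + _ => /(_ I) ->.
Qed.

Lemma ae_dist_in_measure f f' g g' :
  cmeasurable f -> cmeasurable f' -> cmeasurable g -> cmeasurable g' ->
  f = f' %[ae mu] -> g = g' %[ae mu] ->
  dist_in_measure mu f g = dist_in_measure mu f' g'.
Proof.
move=> mf mf' mg mg' ff' gg'; rewrite /dist_in_measure; congr inf.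
have mset (t : R) (u v : T -> R[i]) : cmeasurable u -> cmeasurable v ->
    measurable [set x : T | t <= normc (u x - v x)].
  move=> mu0 mv; rewrite -[X in measurable X]setTI.
  rewrite (_ : [set x | _] = (fun x => normc (u x - v x)) @^-1` `[t, +oo[).
    by have := measurable_normc (cmeasurableB mu0 mv); apply.
  by apply/seteqP; split => x /=; rewrite in_itv/= andbT.
have E t : mu [set x | t <= normc (f x - g x)] = mu [set x | t <= normc (f' x - g' x)].
  rewrite -[LHS]mul1e -[RHS]mul1e -!integral_cst; try exact: mset.
  rewrite [LHS]integral_mkcond [RHS]integral_mkcond.
  apply: ae_eq_integral => //.
  - by apply/(measurable_restrictT _ _).1 => //; exact: mset.
  - by apply/(measurable_restrictT _ _).1 => //; exact: mset.
  - apply: filterS2 ff' gg' => x /(_ I) fx /(_ I) gx _.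
    rewrite /patch; suff -> : (x \in [set x | t <= normc (f x - g x)]) =
        (x \in [set x | t <= normc (f' x - g' x)]) by [].
    by apply/idP/idP; rewrite !inE/= fx gx.
by apply/seteqP; split => _ [t t0 <-]; exists t => //; rewrite E.
Qed.

Lemma ae_eq_rho_fun f f' g g' :
  cmeasurable f -> cmeasurable f' -> cmeasurable g -> cmeasurable g' ->
  f = f' %[ae mu] -> g = g' %[ae mu] ->
  rho_fun mu p f g = rho_fun mu p f' g'.
Proof.
move=> mf mf' mg mg' ff' gg'.
suff E : lognorm mu p (fun x => f x - g x) = lognorm mu p (fun x => f' x - g' x).
  by rewrite /rho_fun E.
apply: (congr1 (fun a : R => a `^ p^-1)).
have m (u v : T -> R[i]) : cmeasurable u -> cmeasurable v ->
    measurable_fun setT (fun x => ln (1 + normc (u x - v x)) `^ p).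
  move=> mu0 mv; apply: (measurableT_comp (measurable_powR p)).
  apply: (measurableT_comp (@measurable_ln R)); apply: measurable_funD => //.
  exact/measurable_normc/cmeasurableB.
apply: ae_eq_Rintegral; [exact: m|exact: m|].
by apply: filterS2 ff' gg' => x + + _ => /(_ I) -> /(_ I) ->.
Qed.

Lemma ae_eq_d_fun f f' g g' :
  cmeasurable f -> cmeasurable f' -> cmeasurable g -> cmeasurable g' ->
  f = f' %[ae mu] -> g = g' %[ae mu] ->
  d_fun mu p f g = d_fun mu p f' g'.
Proof.
move=> mf mf' mg mg' ff' gg'.
rewrite /d_fun (ae_dist_in_measure mf mf' mg mg' ff' gg').
apply: (congr1 (fun a : R => _ + a)).
have m (u v : T -> R[i]) : cmeasurable u -> cmeasurable v -> measurable_fun setT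
    (fun x => `|logp (normc (u x)) `^ p - logp (normc (v x)) `^ p|).
  move=> mu0 mv; apply: measurableT_comp => //; apply: measurable_funB;
  by apply: (measurableT_comp (measurable_powR p)); exact: measurable_logp_normc.
apply: ae_eq_Rintegral; [exact: m|exact: m|].
by apply: filterS2 ff' gg' => x + + _ => /(_ I) -> /(_ I) ->.
Qed.

Lemma ae_eq_delta_fun f f' g g' :
  cmeasurable f -> cmeasurable f' -> cmeasurable g -> cmeasurable g' ->
  f = f' %[ae mu] -> g = g' %[ae mu] ->
  delta_fun mu p f g = delta_fun mu p f' g'.
Proof.
move=> mf mf' mg mg' ff' gg'.
rewrite /delta_fun (ae_dist_in_measure mf mf' mg mg' ff' gg').
apply: (congr1 (fun a : R => _ + a `^ _)).
have m (u v : T -> R[i]) : cmeasurable u -> cmeasurable v -> measurable_fun setT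
    (fun x => `|logp (normc (u x)) - logp (normc (v x))| `^ p).
  move=> mu0 mv; apply: (measurableT_comp (measurable_powR p)).
  apply: measurableT_comp => //.
  by apply: measurable_funB; exact: measurable_logp_normc.
apply: ae_eq_Rintegral; [exact: m|exact: m|].
by apply: filterS2 ff' gg' => x + + _ => /(_ I) -> /(_ I) ->.
Qed.

End ae_invariance.

Section Lplus_distances.
Context d (T : measurableType d) (R : realType).
Variables (mu : {measure set T -> \bar R}) (p : R).
Implicit Types F G : Lplus mu p.

(* These do not depend on the representatives chosen by [repr], see [rho_pi],
   [d_pi] and [delta_pi] below. *)
Definition rho_dist F G : R := rho_fun mu p (repr F) (repr G).
Definition d_dist F G : R := d_fun mu p (repr F) (repr G).
Definition delta_dist F G : R := delta_fun mu p (repr F) (repr G).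

Lemma repr_pi_ae (f : LplusFun mu p) :
  (repr (\pi_(Lplus mu p)%qT f) : T -> R[i]) = f %[ae mu].
Proof.
have /eqmodP : (repr (\pi_(Lplus mu p) f) = f %[mod Lplus mu p])%qT.
  by rewrite reprK.
by move=> /asboolP.
Qed.

Lemma rho_pi (f g : LplusFun mu p) :
  rho_dist (\pi_(Lplus mu p)%qT f) (\pi_(Lplus mu p)%qT g) = rho_fun mu p f g.
Proof.
by apply: ae_eq_rho_fun; try exact: Lplus_measurable; exact: repr_pi_ae.
Qed.

Lemma d_pi (f g : LplusFun mu p) :
  d_dist (\pi_(Lplus mu p)%qT f) (\pi_(Lplus mu p)%qT g) = d_fun mu p f g.
Proof.
by apply: ae_eq_d_fun; try exact: Lplus_measurable; exact: repr_pi_ae.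
Qed.

Lemma delta_pi (f g : LplusFun mu p) :
  delta_dist (\pi_(Lplus mu p)%qT f) (\pi_(Lplus mu p)%qT g) = delta_fun mu p f g.
Proof.
by apply: ae_eq_delta_fun; try exact: Lplus_measurable; exact: repr_pi_ae.
Qed.

End Lplus_distances.

(* Main.v *)
Require Import Defs.
From HB Require Import structures.
From mathcomp Require Import all_boot all_order all_algebra.
From mathcomp Require Import all_classical all_reals all_analysis.
From mathcomp Require Import measurable_realfun complex lra.

(* The topologies are compared along the cycle rho -> delta -> d -> rho, showing
   that smallness of one distance to a fixed [f] forces smallness of the next.
   - rho -> delta: [|log^+ |f| - log^+ |g|| <= log (1 + |f - g|)], and Markov's
     inequality bounds the distance in measure.
   - delta -> d: [|a^p - b^p| <= e a^p + C_e |a - b|^p] for [a, b >= 0].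
   - d -> rho: [log (1 + |f - g|)^p] is at most [log (1 + t)^p] where
     [|f - g| < t], and at most
     [K (1 + 2 (log^+ |f|)^p) + K |(log^+ |f|)^p - (log^+ |g|)^p|] everywhere;
     the first summand does not depend on [g], so its integral over the small
     set [|f - g| >= t] is small by absolute continuity of the integral. *)

Set Implicit Arguments.
Unset Strict Implicit.
Unset Printing Implicit Defensive.

Import Order.TTheory GRing.Theory Num.Theory numFieldTopology.Exports.

Local Open Scope classical_set_scope.
Local Open Scope ring_scope.

(** * Elementary inequalities for real powers *)

Section powR_inequalities.
Context {R : realType}.
Implicit Types a b p e : R.

(** The sum is at most twice the larger summand; this covers convex and concave powers alike. *)
Lemma le_powRD_pow2 p a b : 0 < p -> 0 <= a -> 0 <= b ->
  (a + b) `^ p <= 2 `^ p * (a `^ p + b `^ p).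
Proof.
move=> p0; wlog ab : a b / a <= b => [wl a0 b0|a0 b0].
  by have [ab|/ltW ba] := leP a b; [|rewrite addrC [X in _ * X]addrC]; exact: wl.
apply: (@le_trans _ _ ((2 * b) `^ p)).
  by rewrite ge0_ler_powR ?nnegrE ?(ltW p0) ?addr_ge0 ?mulr_ge0// mulrDl !mul1r lerD2r.
by rewrite powRM// ler_wpM2l ?powR_ge0// lerDr powR_ge0.
Qed.

Lemma powR_subadd p a b : 0 < p -> p <= 1 -> 0 <= a -> 0 <= b ->
  (a + b) `^ p <= a `^ p + b `^ p.
Proof.
move=> p0 p1 a0 b0; have := addr_ge0 a0 b0.
rewrite le_eqVlt => /predU1P[<-|ab0].
  by rewrite powR0 ?gt_eqF// addr_ge0 ?powR_ge0.
(* A ratio in [[0, 1]] is at most its [p]-th power when [p <= 1]; the claim is the sum of this bound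
   over [c = a] and [c = b]. *)
have frac c : 0 <= c -> c <= a + b -> c / (a + b) * (a + b) `^ p <= c `^ p.
  move=> c0 cab; rewrite -[in leRHS](divfK (lt0r_neq0 ab0) c) powRM ?divr_ge0 ?(ltW ab0)//.
  rewrite ler_wpM2r ?powR_ge0//.
  have := c0; rewrite le_eqVlt => /predU1P[<-|c_gt0]; first by rewrite mul0r powR_ge0.
  by rewrite ger1_powR// divr_gt0//= ler_pdivrMr// mul1r.
rewrite -[leLHS]mul1r -(divff (lt0r_neq0 ab0)) mulrDl mulrDl.
by rewrite lerD// frac// ?lerDl ?lerDr.
Qed.

(* If [a] and [b] agree up to the factor [(1 + e) `^ p^-1] the first term
   suffices, otherwise [|b - a|] is comparable to [max a b]. *)
Lemma powR_dist_le p e : 0 < p -> 0 < e -> exists2 C : R, 0 <= C &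
  forall a b, 0 <= a -> 0 <= b ->
    `|a `^ p - b `^ p| <= e * a `^ p + C * `|a - b| `^ p.
Proof.
move=> p0 e0; set c := (1 + e) `^ p^-1.
have cp : c `^ p = 1 + e.
  by rewrite -powRrM mulVf ?gt_eqF// powRr1// addr_ge0// ltW.
have c1 : 1 < c.
  have <- : 1 `^ p^-1 = 1 :> R by rewrite powR1.
  by rewrite gt0_ltr_powR ?invr_gt0 ?nnegrE//; lra.
have k0 : 0 < 1 - c^-1 by rewrite subr_gt0 invf_lt1// (lt_trans ltr01).
exists ((1 - c^-1)^-1 `^ p) => [|a b a0 b0]; first exact: powR_ge0.
have mono u v : 0 <= u -> 0 <= v -> u <= v -> u `^ p <= v `^ p.
  by move=> u0 v0 uv; rewrite ge0_ler_powR ?nnegrE ?(ltW p0).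
(* Here [u < v / c], so [v - u] is at least [(1 - c^-1) * v], and the difference of the powers is at
   most the power of [v]. *)
have far u v : 0 <= u -> 0 <= v -> c * u < v ->
    `|u `^ p - v `^ p| <= (1 - c^-1)^-1 `^ p * `|u - v| `^ p.
  move=> u0 v0 uv; have uv' : u <= v.
    by apply: le_trans (ltW uv); rewrite ler_peMl// ltW.
  rewrite distrC ger0_norm ?subr_ge0 ?mono// -powRM ?invr_ge0 ?(ltW k0)//.
  apply: le_trans (_ : v `^ p <= _); first by rewrite gerBl powR_ge0.
  apply: mono => //; first by rewrite mulr_ge0 ?invr_ge0 ?(ltW k0).
  rewrite ler_pdivlMl// distrC ger0_norm ?subr_ge0// mulrBl mul1r lerB//.
  by rewrite ler_pdivlMl ?(lt_trans ltr01)// ltW.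
have [ba|cab] := leP b (c * a); last first.
  by apply: le_trans (far _ _ a0 b0 cab) _; rewrite lerDr mulr_ge0 ?powR_ge0 ?(ltW e0).
have [ab|cba] := leP a (c * b); last first.
  rewrite distrC (distrC a).
  by apply: le_trans (far _ _ b0 a0 cba) _; rewrite lerDr mulr_ge0 ?powR_ge0 ?(ltW e0).
apply: (@le_trans _ _ (e * a `^ p)); last by rewrite lerDl mulr_ge0 ?powR_ge0.
have c0 : 0 <= c by rewrite powR_ge0.
have := mono _ _ b0 (mulr_ge0 c0 a0) ba; have := mono _ _ a0 (mulr_ge0 c0 b0) ab.
rewrite !powRM// cp => h1 h2; rewrite ler_norml; apply/andP; split; first lra.
(* For the upper bound, the difference of powers is nonpositive if [a <= b]; otherwise it is at most
   [e] times the power of [b], hence of [a]. *)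
have [/mono ab'|/ltW/mono ba'] := leP a b.
  by have := ab' a0 b0; have := mulr_ge0 (ltW e0) (powR_ge0 a p); lra.
have := ler_wpM2l (ltW e0) (ba' b0 a0); lra.
Qed.

End powR_inequalities.

(** * Inequalities for [ln (1 + a)] and [logp] *)

Section logarithmic_inequalities.
Context {R : realType}.
Implicit Types a b : R.

Lemma ln1D_ge0 a : 0 <= a -> 0 <= ln (1 + a).
Proof. by move=> a0; rewrite ln_ge0// lerDl. Qed.

Lemma le_ln1D a b : 0 <= a -> a <= b -> ln (1 + a) <= ln (1 + b).
Proof. by move=> a0 ab; rewrite ler_ln ?posrE; lra. Qed.

Lemma ln1D_subadd a b : 0 <= a -> 0 <= b ->
  ln (1 + (a + b)) <= ln (1 + a) + ln (1 + b).
Proof.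
move=> a0 b0; rewrite -lnM ?posrE; [|lra|lra].
rewrite ler_ln ?posrE; have := mulr_ge0 a0 b0; nra.
Qed.

Lemma logp_ge0 a : 0 <= logp a.
Proof. by rewrite /logp le_max lexx orbT. Qed.

(** With the maximum inside the logarithm, estimates on [logp] become comparisons of products of
    positive numbers. *)
Lemma logpE a : logp a = ln (Num.max 1 a).
Proof.
rewrite /logp; have [a1|a1] := leP a 1.
  by rewrite ln1; apply/max_idPr/ln_le0.
by apply/max_idPl/ln_ge0/ltW.
Qed.

Lemma logp_le_ln1D a : 0 <= a -> logp a <= ln (1 + a).
Proof.
by move=> a0; rewrite logpE ler_ln ?posrE ?lt_max ?ltr01 ?ge_max; lra.
Qed.

Lemma ln1D_le_logp a : 0 <= a -> ln (1 + a) <= ln 2 + logp a.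
Proof.
move=> a0; rewrite logpE -lnM ?posrE ?lt_max ?ltr01//.
have := lexx (Num.max 1 a); rewrite {1}ge_max => /andP[h1 h2].
by rewrite ler_ln ?posrE; lra.
Qed.

(** For [b <= a] this is the logarithm of [max 1 a <= max 1 b * (1 + (a - b))], which holds because
    [max 1 b] is at least both [1] and [b]. *)
Lemma logp_dist a b : 0 <= a -> 0 <= b ->
  `|logp a - logp b| <= ln (1 + `|a - b|).
Proof.
wlog ab : a b / b <= a => [wl a0 b0|a0 b0].
  have [ba|/ltW ab] := leP b a; first exact: wl.
  by rewrite distrC (distrC a); exact: wl.
have h1 : Num.max 1 b <= Num.max 1 a.
  by rewrite ge_max !le_max lexx ab orbT.
have h2 : 1 <= Num.max 1 b by rewrite le_max lexx.
rewrite !logpE !ger0_norm ?subr_ge0 ?ler_ln ?posrE; try lra.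
rewrite lerBlDl -lnM ?posrE; try lra.
rewrite ler_ln ?posrE; try nra.
have hb : b <= Num.max 1 b by rewrite le_max lexx orbT.
by rewrite ge_max; apply/andP; split; nra.
Qed.

End logarithmic_inequalities.

(** * The same inequalities for moduli of complex numbers *)

Section normc_inequalities.
Context {R : realType}.
Implicit Types x y z : R[i].

Lemma normc_ge0 x : 0 <= normc x.
Proof. by case: x => a b; exact: sqrtr_ge0. Qed.

Lemma normcBC x y : normc (x - y) = normc (y - x).
Proof. by rewrite -opprB; exact: normcN. Qed.

Lemma normc_triangle x y z : normc (x - z) <= normc (x - y) + normc (y - z).
Proof. by rewrite -(subrKA y x); exact: le_normcD. Qed.

Lemma normcB_le x y : normc (x - y) <= normc x + normc y.
Proof. by have := normc_triangle x 0 y; rewrite subr0 sub0r (normcN y). Qed.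

Lemma normc_dist x y : `|normc x - normc y| <= normc (x - y).
Proof.
have h u v : normc u - normc v <= normc (u - v).
  by rewrite lerBlDr -{1}(subrK v u); exact: le_normcD.
by rewrite ler_norml h lerNl opprB normcBC h.
Qed.

Lemma ln1_normcB_triangle x y z :
  ln (1 + normc (x - z)) <= ln (1 + normc (x - y)) + ln (1 + normc (y - z)).
Proof.
apply: le_trans (ln1D_subadd (normc_ge0 _) (normc_ge0 _)).
by rewrite le_ln1D ?normc_ge0// normc_triangle.
Qed.

Lemma logp_normc_dist x y :
  `|logp (normc x) - logp (normc y)| <= ln (1 + normc (x - y)).
Proof.
apply: (le_trans (logp_dist (normc_ge0 _) (normc_ge0 _))).
by rewrite le_ln1D// normc_dist.
Qed.

Lemma ln1_normcB_le x y :
  ln (1 + normc (x - y)) <= ln 2 + logp (normc x) + (ln 2 + logp (normc y)).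
Proof.
apply: le_trans (lerD (ln1D_le_logp (normc_ge0 x)) (ln1D_le_logp (normc_ge0 y))).
apply: le_trans (ln1D_subadd (normc_ge0 _) (normc_ge0 _)).
by rewrite le_ln1D ?normc_ge0// normcB_le.
Qed.

End normc_inequalities.

(** * The distance in measure *)

Section distance_in_measure.
Context d (T : measurableType d) (R : realType).
Variable mu : {finite_measure set T -> \bar R}.
Implicit Types f g h : T -> R[i].

Local Notation level f g t := [set x | t <= normc (f x - g x)].

Lemma measurable_level f g (t : R) : cmeasurable f -> cmeasurable g ->
  measurable (level f g t).
Proof.
move=> mf mg; rewrite -[X in measurable X]setTI.
rewrite (_ : level f g t = (fun x => normc (f x - g x)) @^-1` `[t, +oo[).
  by apply: measurable_normc (cmeasurableB mf mg) _ _ _.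
by apply/seteqP; split => x /=; rewrite in_itv/= andbT.
Qed.

Lemma fine_measure_le (A B : set T) : measurable A -> measurable B -> A `<=` B ->
  fine (mu A) <= fine (mu B).
Proof.
move=> mA mB AB; rewrite fine_le ?fin_num_measure//.
by rewrite le_measure ?inE.
Qed.

Lemma dist_in_measure_le f g t : 0 < t ->
  dist_in_measure mu f g <= t + fine (mu (level f g t)).
Proof.
move=> t0; apply: ge_inf; last by exists t.
by exists 0 => _ [s /= s0 <-]; rewrite addr_ge0 ?fine_ge0// ltW.
Qed.

Lemma le_dist_in_measure f g c :
  (forall t, 0 < t -> c <= t + fine (mu (level f g t))) ->
  c <= dist_in_measure mu f g.
Proof.
move=> h; apply: lb_le_inf; first by exists (1 + fine (mu (level f g 1))), 1 => /=.
by move=> _ [t /= t0 <-]; exact: h.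
Qed.

Lemma dist_in_measure_lt f g e : dist_in_measure mu f g < e ->
  exists2 t, 0 < t & t + fine (mu (level f g t)) < e.
Proof.
move=> he; apply/not_exists2P => h; move: he; apply/negP; rewrite -leNgt.
apply: le_dist_in_measure => t t0; rewrite leNgt; apply/negP => te.
by have [] := h t.
Qed.

Lemma dist_in_measure_ge0 f g : 0 <= dist_in_measure mu f g.
Proof.
by apply: le_dist_in_measure => t t0; rewrite addr_ge0 ?fine_ge0// ltW.
Qed.

Lemma dist_in_measureC f g : dist_in_measure mu f g = dist_in_measure mu g f.
Proof.
rewrite /dist_in_measure; congr inf; apply/seteqP.
by split => _ [t t0 <-]; exists t => //; congr (_ + fine (mu _));
  apply/seteqP; split => x /=; rewrite normcBC.
Qed.

Lemma dist_in_measurexx f : dist_in_measure mu f f = 0.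
Proof.
apply/eqP; rewrite eq_le dist_in_measure_ge0 andbT; apply/ler_addgt0Pl => t t0.
rewrite addr0; apply: (le_trans (dist_in_measure_le f f t0)).
rewrite (_ : level f f t = set0) ?measure0 ?addr0//.
by apply/seteqP; split => x //=; rewrite subrr Normc.normc0 leNgt t0.
Qed.

(** Where [|f - h| >= t + s], either [|f - g| >= t] or [|g - h| >= s], so the measures add up; the
    infima over [s] and [t] are taken one after the other. *)
Lemma dist_in_measure_triangle f g h :
  cmeasurable f -> cmeasurable g -> cmeasurable h ->
  dist_in_measure mu f h <= dist_in_measure mu f g + dist_in_measure mu g h.
Proof.
move=> mf mg mh; rewrite -lerBlDl; apply: le_dist_in_measure => s s0.
rewrite lerBlDl -lerBlDr; apply: le_dist_in_measure => t t0.
rewrite lerBlDr; apply: (le_trans (dist_in_measure_le f h (addr_gt0 t0 s0))).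
rewrite addrACA lerD2l.
have mA := measurable_level t mf mg; have mB := measurable_level s mg mh.
have mC := measurable_level (t + s) mf mh; have mAB := measurableU _ _ mA mB.
rewrite -fineD ?fin_num_measure// fine_le ?fin_numD ?fin_num_measure//.
apply: le_trans (measureU2 mu mA mB); rewrite le_measure ?inE//=.
move=> x /= tsx; have [tx|xt] := leP t (normc (f x - g x)); first by left.
right; rewrite /= leNgt; apply/negP => xs; move: tsx; apply/negP.
by rewrite -ltNge (le_lt_trans (normc_triangle _ (g x) _))// ltrD.
Qed.

Lemma dist_in_measure_eq0 f g : cmeasurable f -> cmeasurable g ->
  dist_in_measure mu f g = 0 -> f = g %[ae mu].
Proof.
move=> mf mg fg0.
have level0 s : 0 < s -> mu (level f g s) = 0%E.
  move=> s0; have ms := measurable_level s mf mg.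
  rewrite -[LHS]fineK ?fin_num_measure//; congr EFin.
  apply/eqP; rewrite eq_le fine_ge0// andbT; apply/ler_addgt0Pl => e e0.
  (* The minimum yields a level [t <= s] whose set has measure below [e]; that set contains the
     level set at [s]. *)
  have : dist_in_measure mu f g < Num.min e s by rewrite fg0 lt_min e0.
  move=> /dist_in_measure_lt[t t0]; rewrite lt_min => /andP[te ts].
  have {}ts : t <= s by apply: le_trans (ltW ts); rewrite lerDl fine_ge0.
  rewrite addr0; apply: le_trans (ltW te).
  apply: (@le_trans _ _ (fine (mu (level f g t)))); last by rewrite lerDr ltW.
  apply: fine_measure_le => //; first exact: measurable_level.
  by move=> x /=; exact: le_trans.
(* The set where [f] and [g] differ is the countable union of the level sets at [1 / (n + 1)]. *)
have /ae_foralln : forall n : nat, \forall x \ae mu, ~ level f g n.+1%:R^-1 x.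
  move=> n; exists (level f g n.+1%:R^-1); split.
  - exact: measurable_level.
  - exact: level0.
  - by move=> x /= /contrapT.
apply: filterS => x hx _; apply/eqP; rewrite -subr_eq0; apply/eqP/Normc.eq0_normc.
apply/eqP; rewrite eq_le normc_ge0 andbT leNgt; apply/negP => fgx.
have [n _ /(_ n (leqnn n)) /= hn] := near_infty_natSinv_lt (PosNum fgx).
by apply: (hx n) => /=; exact/ltW.
Qed.

End distance_in_measure.

(** * Integrals of powers and their triangle inequality *)

Section integral_functionals.
Context d (T : measurableType d) (R : realType).
Variable mu : {measure set T -> \bar R}.
Implicit Types (u v w : T -> R) (p : R).

Local Notation integrable u := (mu.-integrable setT (EFin \o u)).

Lemma integrable_le u v : measurable_fun setT u ->
  (forall x, 0 <= u x <= v x) -> integrable v -> integrable u.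
Proof.
move=> mu_ uv; apply: le_integrable => //; first exact/measurable_EFinP.
move=> x _; have /andP[u0 uvx] := uv x.
by rewrite /= lee_fin !ger0_norm// (le_trans u0).
Qed.

Lemma integrableD_EFin u v : integrable u -> integrable v ->
  integrable (fun x => u x + v x).
Proof. by move=> iu iv; exact: (integrableD measurableT iu iv). Qed.

Lemma integrableZl_EFin (k : R) u : integrable u -> integrable (fun x => k * u x).
Proof. by move=> iu; exact: (integrableZl measurableT k iu). Qed.

Lemma Rintegral_eq0_ae u : integrable u -> (forall x, 0 <= u x) ->
  (\int[mu]_x u x)%R = 0 -> \forall x \ae mu, u x = 0.
Proof.
move=> iu u0 Iu; have mu_ := measurable_int mu iu.
have /(ae_eq_integral_abs mu measurableT mu_) : (\int[mu]_x `|(EFin \o u) x|)%E = 0%E.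
  under eq_integral do rewrite gee0_abs ?lee_fin//.
  by rewrite -[LHS]fineK ?integrable_fin_num//; congr EFin.
by apply: filterS => x /(_ I) [].
Qed.

(* The exponent unifies the two cases of [rho_fun]: L^p norm for [1 <= p], plain
   integral of [u `^ p] for [p <= 1]. *)
Definition lp_size p u : R := (\int[mu]_x (u x `^ p))%R `^ (Num.max p 1)^-1.

Lemma max_p1_gt0 p : 0 < Num.max p 1.
Proof. by rewrite lt_max ltr01 orbT. Qed.

Lemma eq_lp_size p u v : u =1 v -> lp_size p u = lp_size p v.
Proof. by move=> /funext ->. Qed.

Lemma lp_size_ge0 p u : 0 <= lp_size p u.
Proof. exact: powR_ge0. Qed.

Lemma Rintegral_powR_ge0 p u : 0 <= (\int[mu]_x (u x `^ p))%R.
Proof. by apply: Rintegral_ge0 => x _; exact: powR_ge0. Qed.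

Lemma lp_size_le1 p u : p <= 1 -> lp_size p u = (\int[mu]_x (u x `^ p))%R.
Proof.
by move=> p1; rewrite /lp_size (max_idPr p1) invr1 powRr1 ?Rintegral_powR_ge0.
Qed.

Lemma lp_size_le p u v : integrable (fun x => u x `^ p) ->
  integrable (fun x => v x `^ p) -> (forall x, u x `^ p <= v x `^ p) ->
  lp_size p u <= lp_size p v.
Proof.
move=> iu iv uv; apply: ge0_ler_powR; rewrite ?nnegrE ?Rintegral_powR_ge0//.
  by rewrite invr_ge0 (ltW (max_p1_gt0 _)).
exact: le_Rintegral.
Qed.

(** Strict monotonicity of the outer power. It lets the smallness arguments work with the plain
    integral, whatever the sign of [p - 1]. *)
Lemma lp_size_ltP p u (c : R) : 0 < c ->
  (lp_size p u < c `^ (Num.max p 1)^-1) = ((\int[mu]_x (u x `^ p))%R < c).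
Proof.
move=> c0; have I0 := Rintegral_powR_ge0 p u.
have m0 : 0 < (Num.max p 1)^-1 by rewrite invr_gt0 max_p1_gt0.
have [h|h] := ltP (\int[mu]_x (u x `^ p))%R c.
  by rewrite gt0_ltr_powR ?nnegrE// ltW.
by apply/negbTE; rewrite -leNgt ge0_ler_powR ?nnegrE ?(ltW c0) ?(ltW m0).
Qed.

Lemma lp_size_eq0 p u : 0 < p -> integrable (fun x => u x `^ p) ->
  lp_size p u = 0 -> \forall x \ae mu, u x = 0.
Proof.
move=> p0 iu /powR_eq0_eq0 /(Rintegral_eq0_ae iu (fun x => powR_ge0 (u x) p)).
by apply: filterS => x /powR_eq0_eq0.
Qed.

(** For [p <= 1] the power is subadditive pointwise; for [p > 1] this is Minkowski's inequality. *)
Lemma lp_size_triangle p u v w : 0 < p ->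
  measurable_fun setT v -> measurable_fun setT w ->
  (forall x, [/\ 0 <= u x, 0 <= v x, 0 <= w x & u x <= v x + w x]) ->
  integrable (fun x => u x `^ p) -> integrable (fun x => v x `^ p) ->
  integrable (fun x => w x `^ p) ->
  lp_size p u <= lp_size p v + lp_size p w.
Proof.
move=> p0 mv mw uvw iu iv iw.
have le_powR x : u x `^ p <= (v x + w x) `^ p.
  have [u0 v0 w0 uvwx] := uvw x.
  by rewrite ge0_ler_powR ?nnegrE ?(ltW p0) ?addr_ge0.
have [p1|/ltW p1] := leP p 1.
  rewrite !lp_size_le1// -RintegralD//; apply: le_Rintegral => //.
    exact: integrableD_EFin.
  move=> x _; apply: le_trans (le_powR x) _.
  by have [_ v0 w0 _] := uvw x; exact: powR_subadd.
have ivw : integrable (fun x => (v x + w x) `^ p).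
  apply: (integrable_le (v := fun x => 2 `^ p * (v x `^ p + w x `^ p))).
  - by apply: (measurableT_comp (measurable_powR p)); exact: measurable_funD.
  - move=> x; rewrite powR_ge0/=.
    by have [_ v0 w0 _] := uvw x; exact: le_powRD_pow2.
  - exact/integrableZl_EFin/integrableD_EFin.
apply: (le_trans (lp_size_le iu ivw le_powR)).
(* Minkowski's inequality concerns extended-real norms; integrability makes their passage to
   [lp_size] lossless. *)
have LnormE h : (forall x, 0 <= h x) -> integrable (fun x => h x `^ p) ->
    'N[mu]_p%:E[EFin \o h]%E = (lp_size p h)%:E.
  move=> h0 ih; rewrite unlock /= /lp_size (max_idPl p1) -poweR_EFin; congr poweR.
  rewrite /Rintegral fineK; last exact: integrable_fin_num.
  by apply: eq_integral => x _; rewrite /= ger0_norm.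
have v0 x : 0 <= v x by have [] := uvw x.
have w0 x : 0 <= w x by have [] := uvw x.
have vw0 x : 0 <= (v \+ w) x by rewrite addr_ge0.
have := minkowski_EFin mu mv mw p1.
by rewrite (LnormE _ vw0 ivw) (LnormE _ v0 iv) (LnormE _ w0 iw).
Qed.

End integral_functionals.

(** * Measurability and integrability of the logarithmic integrands *)

Section Lplus_functions.
Context d (T : measurableType d) (R : realType).
Variables (mu : {finite_measure set T -> \bar R}) (p : R).
Context (p_gt0 : 0 < p).
Local Notation L := (LplusFun mu p).
Implicit Types f g h : L.

Local Notation integrable u := (mu.-integrable setT (EFin \o u)).
Local Notation logdiff f g := (fun x => ln (1 + normc (f x - g x))).
Local Notation logpdiff f g :=
  (fun x => `|logp (normc (f x)) - logp (normc (g x))|).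
Local Notation logp_powdiff f g :=
  (fun x => `|logp (normc (f x)) `^ p - logp (normc (g x)) `^ p|).
Local Notation level f g t := [set x | t <= normc (f x - g x)].

Lemma measurable_logp f : measurable_fun setT (fun x => logp (normc (f x))).
Proof. exact: measurable_logp_normc (Lplus_measurable f). Qed.

Lemma measurable_logdiff f g : measurable_fun setT (logdiff f g).
Proof.
apply: (measurableT_comp (@measurable_ln R)); apply: measurable_funD => //.
exact/measurable_normc/(cmeasurableB (Lplus_measurable f) (Lplus_measurable g)).
Qed.

Lemma measurable_logpdiff f g : measurable_fun setT (logpdiff f g).
Proof.
apply: measurableT_comp => //.
by apply: measurable_funB; exact: measurable_logp.
Qed.

Lemma integrable_logp_pow f : integrable (fun x => logp (normc (f x)) `^ p).
Proof.
apply/integrableP; split.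
  by apply/measurable_EFinP/(measurableT_comp (measurable_powR p))/measurable_logp.
under eq_integral do rewrite gee0_abs ?lee_fin ?powR_ge0//.
exact: Lplus_finite.
Qed.

Lemma integrable_cst (c : R) : integrable (fun=> c).
Proof. exact: (finite_measure_integrable_cst mu c measurableT). Qed.

Lemma integrable_logp_powdiff f g : integrable (logp_powdiff f g).
Proof.
apply: (integrable_le (v := fun x => logp (normc (f x)) `^ p + logp (normc (g x)) `^ p)).
- apply: measurableT_comp => //; apply: measurable_funB;
  by apply/(measurableT_comp (measurable_powR p))/measurable_logp.
- move=> x; rewrite normr_ge0/=; apply: le_trans (ler_normB _ _) _.
  by rewrite !ger0_norm ?powR_ge0.
- by apply: integrableD_EFin; exact: integrable_logp_pow.
Qed.

(** After [ln1_normcB_le] and two uses of [le_powRD_pow2], the power of [logp |g|] is replaced by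
    that of [logp |f|] plus the difference of the two, so that [g] enters only through
    [logp_powdiff]. *)
Lemma logdiff_pow_bound : exists2 K : R, 0 < K & forall f g x,
  logdiff f g x `^ p <=
    K * (1 + 2 * logp (normc (f x)) `^ p) + K * logp_powdiff f g x.
Proof.
have p2 : 0 < (2 : R) `^ p by rewrite powR_gt0.
have l2 : 0 <= ln (2 : R) by rewrite ln_ge0// ler1n.
set c : R := (2 * ln 2) `^ p; have c0 : 0 <= c by rewrite powR_ge0.
exists (2 `^ p * (c + 2 `^ p)) => [|f g x]; first by rewrite mulr_gt0// ltr_wpDl.
set a := logp _; set b := logp (normc (g x)).
have a0 : 0 <= a by exact: logp_ge0.
have b0 : 0 <= b by exact: logp_ge0.
apply: (@le_trans _ _ ((2 * ln 2 + (a + b)) `^ p)).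
  rewrite ge0_ler_powR ?nnegrE ?(ltW p_gt0) ?ln1D_ge0 ?normc_ge0 ?addr_ge0 ?mulr_ge0//.
  by apply: (le_trans (ln1_normcB_le _ _)); rewrite -/a -/b; lra.
apply: (le_trans (le_powRD_pow2 p_gt0 _ _)); rewrite ?addr_ge0 ?mulr_ge0//.
have h := le_powRD_pow2 p_gt0 a0 b0.
rewrite -mulrDr -[leRHS]mulrA ler_pM2l// -/c.
have hw : b `^ p <= a `^ p + `|a `^ p - b `^ p|.
  by rewrite -lerBlDl distrC ler_norm.
move: h hw p2 c0 (powR_ge0 a p) (powR_ge0 b p).
move: (2 `^ p) (a `^ p) (b `^ p) ((a + b) `^ p) (`|_|) => q u v s w.
move=> h vuw q0 c0 u0 v0.
have := ler_wpM2l (ltW q0) vuw.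
(* This product and [q] are the surplus of the right-hand side once [v] has been bounded by
   [u + w]. *)
have : 0 <= c * (u + (u + w)) by rewrite mulr_ge0//; lra.
nra.
Qed.

Lemma integrable_logdiff_pow f g : integrable (fun x => logdiff f g x `^ p).
Proof.
have [K K0 hK] := logdiff_pow_bound.
apply: (integrable_le (v := fun x =>
  K * (1 + 2 * logp (normc (f x)) `^ p) + K * logp_powdiff f g x)).
- exact/(measurableT_comp (measurable_powR p))/measurable_logdiff.
- by move=> x; rewrite powR_ge0 hK.
- apply: integrableD_EFin; apply: integrableZl_EFin.
    apply: integrableD_EFin; first exact: integrable_cst.
    exact/integrableZl_EFin/integrable_logp_pow.
  exact: integrable_logp_powdiff.
Qed.

Lemma logpdiff_pow_le f g x : logpdiff f g x `^ p <= logdiff f g x `^ p.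
Proof.
by rewrite ge0_ler_powR ?nnegrE ?(ltW p_gt0) ?ln1D_ge0 ?normc_ge0 ?logp_normc_dist.
Qed.

Lemma integrable_logpdiff_pow f g : integrable (fun x => logpdiff f g x `^ p).
Proof.
apply: (integrable_le (v := fun x => logdiff f g x `^ p)).
- exact/(measurableT_comp (measurable_powR p))/measurable_logpdiff.
- by move=> x; rewrite powR_ge0 logpdiff_pow_le.
- exact: integrable_logdiff_pow.
Qed.

Lemma rho_funE f g : rho_fun mu p f g = lp_size mu p (logdiff f g).
Proof.
rewrite /rho_fun /lognorm /lp_size; have [//|p1] := ltP 1 p.
by rewrite invr1 -powRrM mulVf ?gt_eqF.
Qed.

Lemma delta_funE f g :
  delta_fun mu p f g = dist_in_measure mu f g + lp_size mu p (logpdiff f g).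
Proof. by []. Qed.

(** * Smallness of one distance forces smallness of the next *)

(** Markov's inequality: on the level set the integrand is at least the [p]-th power of
    [ln (1 + t)]. *)
Lemma measure_level_lt_of_logdiff f g (t c : R) : 0 < t -> 0 < c ->
  (\int[mu]_x (logdiff f g x `^ p))%R < ln (1 + t) `^ p * c ->
  fine (mu (level f g t)) < c.
Proof.
move=> t0 c0 Ic; have l0 : 0 < ln (1 + t) `^ p.
  by rewrite powR_gt0// ln_gt0// ltrDl.
have mE := measurable_level t (Lplus_measurable f) (Lplus_measurable g).
rewrite -(ltr_pM2l l0); apply: le_lt_trans Ic.
rewrite -(Rintegral_cst mu mE) Rintegral_mkcond.
apply: (le_Rintegral measurableT).
- have /(integrable_mkcond _ mE) :
      mu.-integrable (level f g t) (EFin \o cst (ln (1 + t) `^ p)).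
    exact: finite_measure_integrable_cst.
  by rewrite restrict_EFin.
- exact: integrable_logdiff_pow.
- move=> x _; rewrite patchE; case: ifPn => [|_]; last exact: powR_ge0.
  rewrite inE/= => tx.
  by rewrite ge0_ler_powR ?nnegrE ?(ltW p_gt0) ?ln1D_ge0 ?normc_ge0
    ?(ltW t0) ?le_ln1D ?(ltW t0).
Qed.

Lemma delta_small_of_rho_small e : 0 < e -> exists2 r : R, 0 < r &
  forall f g, rho_fun mu p f g < r -> delta_fun mu p f g < e.
Proof.
move=> e0; have sum_lt : e / 4 + e / 4 + (e / 4) < e by lra.
have e4 : 0 < e / 4 by rewrite divr_gt0.
(* An integral below [c] leaves measure below [e / 4] at level [e / 4]; these two and the integral
   term of [delta_fun] give three quarters of [e]. *)
set c := ln (1 + e / 4) `^ p * (e / 4).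
have c0 : 0 < c by rewrite mulr_gt0// powR_gt0// ln_gt0// ltrDl.
exists (Num.min (e / 4) (c `^ (Num.max p 1)^-1)) => [|f g].
  by rewrite lt_min e4 powR_gt0.
rewrite rho_funE lt_min => /andP[he]; rewrite lp_size_ltP// => hc.
rewrite delta_funE.
have h1 := measure_level_lt_of_logdiff e4 e4 hc.
have h2 := dist_in_measure_le mu f g e4.
have h3 := lp_size_le (integrable_logpdiff_pow f g) (integrable_logdiff_pow f g)
  (logpdiff_pow_le f g).
apply: le_lt_trans (lerD (le_trans h2 (lerD (lexx _) (ltW h1))) (le_trans h3 (ltW he))) _.
exact: sum_lt.
Qed.

(** Integrating [powR_dist_le] bounds the integral in [d_fun] by a small multiple of [I] plus
    [C * J]. As [I] depends on [f] only, the multiple is fixed first, then [C], then the bound on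
    [J]. *)
Lemma d_small_of_delta_small f e : 0 < e -> exists2 r : R, 0 < r &
  forall g, delta_fun mu p f g < r -> d_fun mu p f g < e.
Proof.
move=> e0; have sum_le : e / 3 + (e / 3 + e / 3) <= e by lra.
set I := (\int[mu]_x (logp (normc (f x)) `^ p))%R.
have I0 : 0 <= I by exact: Rintegral_powR_ge0.
have e3 : 0 < e / 3 by rewrite divr_gt0.
(* Times [I] this weight is at most [e / 3]; the added [1] keeps the denominator positive when
   [I = 0]. *)
have ei0 : 0 < e / 3 / (1 + I) by rewrite divr_gt0// ltr_wpDr.
have [C C0 hC] := powR_dist_le p_gt0 ei0.
have C1 : 0 < 1 + C by rewrite ltr_wpDr.
set c := e / 3 / (1 + C); have c0 : 0 < c by rewrite divr_gt0.
exists (Num.min (e / 3) (c `^ (Num.max p 1)^-1)) => [|g].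
  by rewrite lt_min e3 powR_gt0.
rewrite delta_funE lt_min => /andP[he hc].
have h1 : dist_in_measure mu f g < e / 3.
  by apply: le_lt_trans he; rewrite lerDl lp_size_ge0.
have {hc} : lp_size mu p (logpdiff f g) < c `^ (Num.max p 1)^-1.
  by apply: le_lt_trans hc; rewrite lerDr dist_in_measure_ge0.
rewrite lp_size_ltP// => hJ; rewrite /d_fun.
set J := (\int[mu]_x _)%R in hJ *; set D := (\int[mu]_x _)%R.
have J0 : 0 <= J by exact: Rintegral_powR_ge0.
have hD : D <= e / 3 / (1 + I) * I + C * J.
  rewrite -RintegralZl//; last exact: integrable_logp_pow.
  rewrite -RintegralZl//; last exact: integrable_logpdiff_pow.
  rewrite -RintegralD//; [|exact/integrableZl_EFin/integrable_logp_pow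
                          |exact/integrableZl_EFin/integrable_logpdiff_pow].
  apply: le_Rintegral => //; first exact: integrable_logp_powdiff.
    by apply: integrableD_EFin; apply: integrableZl_EFin;
      [exact: integrable_logp_pow|exact: integrable_logpdiff_pow].
  by move=> x _; apply: hC; exact: logp_ge0.
have hI : e / 3 / (1 + I) * I <= e / 3.
  by rewrite -mulrA ler_piMr ?(ltW e3)// ler_pdivrMl ?ltr_wpDr// mulr1 lerDr.
have hCJ : C * J <= e / 3.
  apply: (@le_trans _ _ ((1 + C) * c)); last by rewrite mulrC divfK// gt_eqF.
  by rewrite ler_pM// ?lerDr// ltW.
apply: lt_le_trans (ltr_leD h1 (le_trans hD (lerD hI hCJ))) _.
by rewrite sum_le.
Qed.

Lemma rho_small_of_d_small f e : 0 < e -> exists2 r : R, 0 < r &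
  forall g, d_fun mu p f g < r -> rho_fun mu p f g < e.
Proof.
(* By [lp_size_ltP], [rho_fun] is below [e] exactly when the integral is below [h]. *)
move=> e0; set h := e `^ Num.max p 1.
have h0 : 0 < h by rewrite powR_gt0.
have sum_lt : h / 4 + h / 4 + h / 4 < h by lra.
have eE : e = h `^ (Num.max p 1)^-1.
  by rewrite -powRrM divff ?gt_eqF ?max_p1_gt0// powRr1// ltW.
have h4 : 0 < h / 4 by rewrite divr_gt0.
have [K K0 hK] := logdiff_pow_bound.
set H : T -> R := fun x => K * (1 + 2 * logp (normc (f x)) `^ p).
have iH : integrable H.
  apply/integrableZl_EFin/integrableD_EFin; first exact: integrable_cst.
  exact/integrableZl_EFin/integrable_logp_pow.
have H0 x : 0 <= H x.
  by rewrite mulr_ge0 ?(ltW K0)// addr_ge0// mulr_ge0// powR_ge0.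
have [s [s0 hs]] := integral_normr_continuous iH h4.
set M := fine (mu setT); have M0 : 0 <= M by exact: fine_ge0.
set c := h / 4 / (1 + M); have c0 : 0 < c by rewrite divr_gt0// ltr_wpDr.
(* [s] bounds the measure of the level set, for absolute continuity; the power of [c] bounds the
   level [t], so the integrand is at most [c] off that set; the last term makes [K * D < h / 4]. *)
exists (Num.min s (Num.min (c `^ p^-1) (h / 4 / K))) => [|g].
  by rewrite !lt_min s0 powR_gt0//= divr_gt0.
rewrite !lt_min /d_fun; set D := (\int[mu]_x _)%R => /and3P[ds dc dK].
have D0 : 0 <= D by exact: Rintegral_ge0.
have : dist_in_measure mu f g < Num.min s (c `^ p^-1).
  by rewrite lt_min (le_lt_trans _ ds) ?(le_lt_trans _ dc)// lerDl.
move=> /dist_in_measure_lt[t t0]; rewrite lt_min => /andP[ts tc].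
have {}tc : t < c `^ p^-1 by apply: le_lt_trans tc; rewrite lerDl fine_ge0.
have mE := measurable_level t (Lplus_measurable f) (Lplus_measurable g).
have mEs : fine (mu (level f g t)) < s by apply: le_lt_trans ts; rewrite lerDr ltW.
have HE : (\int[mu]_x (H \_ (level f g t)) x)%R < h / 4.
  rewrite -Rintegral_mkcond; apply: le_lt_trans (hs _ mE _); last first.
    by rewrite -[X in (X < _)%E]fineK ?fin_num_measure// lte_fin.
  by rewrite le_eqVlt; apply/orP; left; apply/eqP/eq_Rintegral => x _; rewrite ger0_norm.
(* This rests on [ln (1 + t) <= t]. *)
have lc : ln (1 + t) `^ p <= c.
  have -> : c = (c `^ p^-1) `^ p by rewrite -powRrM mulVf ?gt_eqF// powRr1// ltW.
  rewrite ge0_ler_powR ?nnegrE ?(ltW p_gt0) ?ln1D_ge0 ?powR_ge0 ?(ltW t0)//.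
  by apply: le_trans (ltW tc); rewrite le_ln1Dx// (lt_trans _ t0)// oppr_lt0.
rewrite rho_funE eE lp_size_ltP//.
have iHE : integrable (H \_ (level f g t)).
  have /(integrable_mkcond _ mE) : mu.-integrable (level f g t) (EFin \o H).
    exact: integrableS iH.
  by rewrite restrict_EFin.
have iD : integrable (fun x => K * logp_powdiff f g x).
  exact/integrableZl_EFin/integrable_logp_powdiff.
set J := (\int[mu]_x _)%R.
(* Pointwise, [logdiff_pow_bound] is used on the level set and the constant [c] off it. *)
have hJ : J <= c * M + (\int[mu]_x (H \_ (level f g t)) x)%R + K * D.
  rewrite -(Rintegral_cst mu measurableT) -RintegralZl//; last exact: integrable_logp_powdiff.
  rewrite -RintegralD//; last exact: integrable_cst.
  rewrite -RintegralD//; last by apply: integrableD_EFin => //; exact: integrable_cst.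
  apply: le_Rintegral => //; first exact: integrable_logdiff_pow.
    by do 2 apply: integrableD_EFin => //; exact: integrable_cst.
  move=> x _; rewrite patchE; case: ifPn => [_|].
    by apply: (le_trans (hK f g x)); rewrite lerD2r lerDr ltW.
  rewrite notin_setE/= addr0 => /negP; rewrite -ltNge => xt.
  apply: (@le_trans _ _ c); last by rewrite lerDl mulr_ge0// ltW.
  apply: le_trans lc.
  by rewrite ge0_ler_powR ?nnegrE ?(ltW p_gt0) ?ln1D_ge0 ?normc_ge0
    ?(ltW t0) ?le_ln1D ?normc_ge0 ?(ltW xt).
have hcM : c * M <= h / 4.
  by rewrite /c -mulrA ler_piMr ?(ltW h4)// ler_pdivrMl ?ltr_wpDr// mulr1 lerDr.
have hKD : K * D < h / 4.
  rewrite -ltr_pdivlMl// mulrC; apply: le_lt_trans dK.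
  by rewrite lerDr dist_in_measure_ge0.
apply: le_lt_trans hJ _; apply: lt_trans (ltrD (ler_ltD hcM HE) hKD) _.
exact: sum_lt.
Qed.

(** * Metric axioms and passage to equivalence classes *)

Lemma rho_fun_triangle f g h :
  rho_fun mu p f h <= rho_fun mu p f g + rho_fun mu p g h.
Proof.
rewrite !rho_funE; apply: lp_size_triangle => //; try exact: measurable_logdiff;
  try exact: integrable_logdiff_pow.
by move=> x; rewrite !ln1D_ge0 ?normc_ge0// ln1_normcB_triangle.
Qed.

Lemma delta_fun_triangle f g h :
  delta_fun mu p f h <= delta_fun mu p f g + delta_fun mu p g h.
Proof.
rewrite !delta_funE addrACA lerD//.
  by apply: dist_in_measure_triangle; exact: Lplus_measurable.
apply: lp_size_triangle => //; try exact: measurable_logpdiff;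
  try exact: integrable_logpdiff_pow.
by move=> x; rewrite !normr_ge0 ler_distD.
Qed.

Lemma d_fun_triangle f g h : d_fun mu p f h <= d_fun mu p f g + d_fun mu p g h.
Proof.
rewrite /d_fun addrACA lerD//.
  by apply: dist_in_measure_triangle; exact: Lplus_measurable.
rewrite -RintegralD//; try exact: integrable_logp_powdiff.
apply: le_Rintegral => //; first exact: integrable_logp_powdiff.
  by apply: integrableD_EFin; exact: integrable_logp_powdiff.
by move=> x _; exact: ler_distD.
Qed.

Lemma rho_fun_eq0 f g : rho_fun mu p f g = 0 -> (f : T -> R[i]) = g %[ae mu].
Proof.
rewrite rho_funE => /(lp_size_eq0 p_gt0 (integrable_logdiff_pow f g)).
apply: filterS => x /eqP; rewrite ln_eq0 ?ltr_wpDr ?normc_ge0//.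
rewrite addrC -subr_eq0 addrK => /eqP/Normc.eq0_normc/eqP.
by rewrite subr_eq0 => /eqP.
Qed.

(** Separation comes from the distance in measure, since [logp] takes the value [0] at every modulus
    up to [1]. *)
Lemma delta_fun_eq0 f g : delta_fun mu p f g = 0 -> (f : T -> R[i]) = g %[ae mu].
Proof.
rewrite delta_funE => /eqP; rewrite paddr_eq0 ?dist_in_measure_ge0 ?lp_size_ge0//.
move=> /andP[/eqP + _].
by apply: dist_in_measure_eq0; exact: Lplus_measurable.
Qed.

Lemma d_fun_eq0 f g : d_fun mu p f g = 0 -> (f : T -> R[i]) = g %[ae mu].
Proof.
rewrite /d_fun => /eqP; rewrite paddr_eq0 ?dist_in_measure_ge0 ?Rintegral_ge0//.
move=> /andP[/eqP + _].
by apply: dist_in_measure_eq0; exact: Lplus_measurable.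
Qed.

Lemma rho_funxx f : rho_fun mu p f f = 0.
Proof.
(* Zero to the power zero is [1] for [powR], so both the inner and the outer exponent must be shown
   nonzero. *)
rewrite rho_funE /lp_size; under eq_Rintegral => x _.
  rewrite subrr Normc.normc0 addr0 ln1 powR0 ?gt_eqF//; over.
by rewrite Rintegral_cst// mul0r powR0// invr_eq0 gt_eqF ?max_p1_gt0.
Qed.

Lemma delta_funxx f : delta_fun mu p f f = 0.
Proof.
rewrite delta_funE dist_in_measurexx add0r /lp_size; under eq_Rintegral => x _.
  rewrite subrr normr0 powR0 ?gt_eqF//; over.
by rewrite Rintegral_cst// mul0r powR0// invr_eq0 gt_eqF ?max_p1_gt0.
Qed.

Lemma d_funxx f : d_fun mu p f f = 0.
Proof.
rewrite /d_fun dist_in_measurexx add0r; under eq_Rintegral => x _.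
  rewrite subrr normr0; over.
by rewrite Rintegral_cst// mul0r.
Qed.

Lemma rho_funC f g : rho_fun mu p f g = rho_fun mu p g f.
Proof.
by rewrite !rho_funE; apply: eq_lp_size => x; rewrite normcBC.
Qed.

Lemma delta_funC f g : delta_fun mu p f g = delta_fun mu p g f.
Proof.
rewrite !delta_funE dist_in_measureC; apply: (congr1 (+%R _)).
by apply: eq_lp_size => x; rewrite distrC.
Qed.

Lemma d_funC f g : d_fun mu p f g = d_fun mu p g f.
Proof.
rewrite /d_fun dist_in_measureC; apply: (congr1 (+%R _)).
by apply: eq_Rintegral => x _; rewrite distrC.
Qed.

Lemma Lplus_ae_eq (F G : Lplus mu p) :
  (repr F : T -> R[i]) = repr G %[ae mu] -> F = G.
Proof.
move=> FG; rewrite -[F]reprK -[G]reprK; apply/eqmodP; exact/asboolP.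
Qed.

(** A pseudometric on functions whose zero relation is a.e. equality becomes a metric on classes;
    all three distances are instances. *)
Lemma is_metric_Lplus (D : (T -> R[i]) -> (T -> R[i]) -> R) :
  (forall f g, 0 <= D f g) -> (forall f, D f f = 0) ->
  (forall f g, D f g = 0 -> (f : T -> R[i]) = g %[ae mu]) ->
  (forall f g, D f g = D g f) ->
  (forall f g h, D f h <= D f g + D g h) ->
  is_metric (fun F G : Lplus mu p => D (repr F) (repr G)).
Proof.
move=> D0 Dxx Deq0 DC Dtri; split => // F G; split => [/Deq0/Lplus_ae_eq//|->].
exact: Dxx.
Qed.

End Lplus_functions.

(** * Comparison of the topologies *)

(** Every [D2]-ball contains a [D1]-ball with the same centre. The radius may depend on the centre,
    so estimates at a fixed [f] suffice. *)
Lemma metric_open_sub (R : realType) (X : Type) (D1 D2 : X -> X -> R) :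
  (forall x e, 0 < e -> exists2 r, 0 < r & forall y, D1 x y < r -> D2 x y < e) ->
  forall U, metric_open D2 U -> metric_open D1 U.
Proof.
move=> h U oU x Ux; have [e e0 eU] := oU x Ux; have [r r0 rD] := h x e e0.
by exists r => // y /= /rD; exact: eU.
Qed.

Theorem mainTheorem2 (R : realType) (d : measure_display)
    (T : measurableType d) (mu : {finite_measure set T -> \bar R})
    (mu_complete : measure_is_complete mu)
    (mu_neq0 : exists2 A : set T, measurable A & mu A <> 0%E)
    (p : R) (p_gt0 : 0 < p) :
  [/\ is_metric (@rho_dist d T R mu p),
      is_metric (@d_dist d T R mu p),
      is_metric (@delta_dist d T R mu p),
      same_topology (@rho_dist d T R mu p) (@delta_dist d T R mu p)
    & same_topology (@d_dist d T R mu p) (@delta_dist d T R mu p)].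
Proof.
have delta_rho U : metric_open (@delta_dist d T R mu p) U ->
    metric_open (@rho_dist d T R mu p) U.
  apply: metric_open_sub => F e /(delta_small_of_rho_small mu p_gt0)[r r0 hr].
  by exists r => // G; exact: hr.
have rho_d U : metric_open (@rho_dist d T R mu p) U ->
    metric_open (@d_dist d T R mu p) U.
  apply: metric_open_sub => F e /(rho_small_of_d_small p_gt0 (repr F))[r r0 hr].
  by exists r => // G; exact: hr.
have d_delta U : metric_open (@d_dist d T R mu p) U ->
    metric_open (@delta_dist d T R mu p) U.
  apply: metric_open_sub => F e /(d_small_of_delta_small p_gt0 (repr F))[r r0 hr].
  by exists r => // G; exact: hr.
split.
- apply: is_metric_Lplus.
  + by move=> f g; rewrite rho_funE// lp_size_ge0.
  + exact: rho_funxx.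
  + exact: rho_fun_eq0.
  + exact: rho_funC.
  + exact: rho_fun_triangle.
- apply: is_metric_Lplus.
  + by move=> f g; rewrite addr_ge0 ?dist_in_measure_ge0 ?Rintegral_ge0.
  + exact: d_funxx.
  + exact: d_fun_eq0.
  + exact: d_funC.
  + exact: d_fun_triangle.
- apply: is_metric_Lplus.
  + by move=> f g; rewrite addr_ge0 ?dist_in_measure_ge0 ?powR_ge0.
  + exact: delta_funxx.
  + exact: delta_fun_eq0.
  + exact: delta_funC.
  + exact: delta_fun_triangle.
(* The three inclusions between families of open sets form a cycle, so composing them gives both
   directions of each equivalence. *)
- by move=> U; split => [/rho_d/d_delta|/delta_rho].
- by move=> U; split => [/d_delta|/delta_rho/rho_d].
Qed.
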